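(* Let $p\in[1,\infty)$ and let $\gamma_S$ be a finite Borel measure on $S$ with $\gamma_S(S)>0$ that is strictly positive (every nonempty relatively open subset of $S$ has positive $\gamma_S$-measure). Then $SW_p^\gamma$ is a metric on $\mathcal P_p(X)$: it is finite, symmetric, satisfies the triangle inequality, and $SW_p^\gamma(\mu,\nu)=0$ if and only if $\mu=\nu$.
   Context: $X$ is an infinite-dimensional separable real Hilbert space with inner product $\langle\cdot,\cdot\rangle$ and norm $\|\cdot\|$; $S=\{x\in X:\|x\|=1\}$ with the relative norm topology. $\mathcal P_p(X)$ is the set of Borel probability measures on $X$ with $\int_X\|x\|^p\,d\mu<\infty$. For $\theta\in S$, $P_\theta(x)=\langle\theta,x\rangle$ and $\hat\mu_\theta:=P_\theta\#\mu$. $W_p$ is the $p$-Wasserstein distance on probability measures on $\mathbb R$. The $p$-sliced Wasserstein distance with respect to $\gamma_S$ is $$SW_p^\gamma(\mu,\nu)=\Big(\frac{1}{\gamma_S(S)}\int_S W_p^p(\hat\mu_\theta,\hat\nu_\theta)\,\gamma_S(d\theta)\Big)^{1/p}.$$ (An example of such $\gamma_S$ is the surface measure on $S$ associated with a non-degenerate centered Gaussian measure on $X$.) *)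

(* Defs.v *)
From HB Require Import structures.
From mathcomp Require Import all_boot all_order all_algebra.
From mathcomp Require Import all_classical all_reals all_analysis.
Set Implicit Arguments. Unset Strict Implicit. Unset Printing Implicit Defensive.
Import Order.TTheory GRing.Theory Num.Theory.
Import numFieldNormedType.Exports.
Local Open Scope classical_set_scope.
Local Open Scope ring_scope.

Section Defs.
Context {R : realType}.

Definition is_inner_product (X : normedModType R) (ip : X -> X -> R) : Prop :=
  [/\ (forall x y : X, ip x y = ip y x),
      (forall (a : R) (x y z : X), ip (a *: x + y) z = a * ip x z + ip y z) &
      (forall x : X, ip x x = `|x| ^+ 2)].

Definition separable_space (X : normedModType R) : Prop :=
  exists D : set X, countable D /\ dense D.

Definition infinite_dimensional (X : normedModType R) : Prop :=
  forall (n : nat) (v : 'I_n -> X),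
    exists x : X, forall c : 'I_n -> R, x <> \sum_(i < n) c i *: v i.

Definition borelX (X : normedModType R) := g_sigma_algebraType (@open X).

Definition nrm (X : normedModType R) (x : X) : R := `|x|.

Definition sphere (X : normedModType R) : set (borelX X) :=
  [set x | nrm (x : X) = 1].

Definition proj (X : normedModType R) (ip : X -> X -> R) (theta : X)
  : borelX X -> R := fun x => ip theta x.

Definition proj_push (X : normedModType R) (ip : X -> X -> R)
  (mu : set (borelX X) -> \bar R) (theta : X) : set R -> \bar R :=
  fun A => mu (proj ip theta @^-1` A).

Definition in_Pp (X : normedModType R) (p : R) (mu : probability (borelX X) R) : Prop :=
  (\int[mu]_x ((nrm (x : X)) `^ p)%:E < +oo)%E.

Definition coupling (a b : set R -> \bar R) (pi : probability (R * R)%type R) : Prop :=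
  forall A : set R, measurable A ->
    pi (A `*` setT) = a A /\ pi (setT `*` A) = b A.

Definition Wpp (p : R) (a b : set R -> \bar R) : \bar R :=
  ereal_inf [set (\int[pi]_z ((`|z.1 - z.2|) `^ p)%:E)%E
            | pi in [set pi | coupling a b pi]].

(* gamma is a measure on X concentrated on S (the measure gamma_S on S) *)
Definition SW (X : normedModType R) (ip : X -> X -> R) (p : R)
  (gamma : set (borelX X) -> \bar R) (mu nu : set (borelX X) -> \bar R) : \bar R :=
  (((fine (gamma (@sphere X)))^-1)%:E *
     \int[gamma]_(theta in @sphere X)
        Wpp p (proj_push ip mu theta) (proj_push ip nu theta)) `^ p^-1.

End Defs.

(* Main.v *)
Require Import Defs.
From HB Require Import structures.
From mathcomp Require Import all_boot all_order all_algebra.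
From mathcomp Require Import all_classical all_reals all_analysis.
From mathcomp Require Import measurable_realfun ring lra.
Import Order.TTheory GRing.Theory Num.Theory.
Import numFieldNormedType.Exports.
Local Open Scope classical_set_scope.
Local Open Scope ring_scope.

Set Implicit Arguments.
Unset Strict Implicit.
Unset Printing Implicit Defensive.

(** The triangle inequality for [W_p] on the line needs no disintegration: two plans with a
common marginal [c] are made independent conditionally on the cell of a countable partition
containing the common coordinate, which glues them up to the diameter of the cells, and
Minkowski's inequality on the glued space concludes in the limit.  Consequently
[theta |-> W_p(mu_theta, nu_theta)] is Lipschitz, hence measurable, and the triangle
inequality for [SW] is Minkowski's inequality in [L^p(gamma_S)].

If [SW] vanishes, continuity and strict positivity force [W_p(mu_theta, nu_theta) = 0] for
every [theta] in the sphere, so that all integrals of [cos (<t, x> - c)] agree.  Uniqueness is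
then proved without Fourier inversion.  The bounded functions [f] for which the integrals of
[f cos (<t, x> - c)] agree for all [t] and [c] are stable under multiplication by cosines, and
under bounded pointwise limits.  The polynomials [(1 - u^n)^(n 2^n)] converge on [0, 1] to the
indicator of [u < 1/2]; taken at [u = (1 + sin ((<s, x> - r) / k)) / 2] with [k] going to
infinity, they give the indicator of the half-space [<s, x> < r].  The sets whose indicators
are multipliers of this class form a sigma-algebra containing the half-spaces, hence the closed
balls, hence all Borel sets of the separable space. *)

(** * Wasserstein distance on the line *)

Section wasserstein.
Context {R : realType}.
Implicit Types (a b c : set R -> \bar R) (p : R).

Lemma measurable_fun_cost d (T : measurableType d) (U V : T -> R) p :
  measurable_fun setT U -> measurable_fun setT V ->
  measurable_fun setT (fun t => (`|U t - V t| `^ p)%:E).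
Proof.
move=> mU mV; apply/measurable_EFinP.
apply: (measurableT_comp (measurable_powR p)).
by apply: (measurableT_comp (@normr_measurable _ setT)); exact: measurable_funB.
Qed.

(** The joint law of [U] and [V] is itself a coupling. Upper bounds on the cost can thus be read off
    any probability space carrying both variables. *)
Lemma Wpp_le_joint d (T : measurableType d) (P : probability T R) (U V : T -> R)
    a b p :
  measurable_fun setT U -> measurable_fun setT V ->
  (forall A, measurable A -> a A = P (U @^-1` A)) ->
  (forall A, measurable A -> b A = P (V @^-1` A)) ->
  (Wpp p a b <= \int[P]_t (`|U t - V t| `^ p)%:E)%E.
Proof.
move=> mU mV aE bE; have mUV := measurable_fun_pair mU mV.
pose Z : {mfun T >-> (R * R)%type} :=
  HB.pack (fun t => (U t, V t)) (isMeasurableFun.Build _ _ _ _ _ mUV).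
apply: ereal_inf_lbound; exists (distribution P Z) => /=.
  move=> A mA; rewrite aE// bE// /distribution /pushforward/=.
  by split; congr (P _); apply/seteqP; split=> t /=; tauto.
have mc := measurable_fun_cost p (@measurable_fst _ _ R R) measurable_snd.
by rewrite ge0_integral_pushforward// => z _; rewrite lee_fin powR_ge0.
Qed.

Lemma Wpp_ge0 p a b : (0 <= Wpp p a b)%E.
Proof.
by apply: le_ereal_inf_tmp => _ [pi _ <-]; apply: integral_ge0 => z _; rewrite lee_fin powR_ge0.
Qed.

Lemma Wpp_sym p a b : Wpp p a b = Wpp p b a.
Proof.
suff H a' b' : (Wpp p a' b' <= Wpp p b' a')%E by apply/eqP; rewrite eq_le !H.
apply: le_ereal_inf_tmp => _ [pi /= cpi <-].
under eq_integral do rewrite distrC.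
apply: Wpp_le_joint; [exact: measurable_snd|exact: measurable_fst| |].
- move=> A mA; have [_ <-] := cpi _ mA; congr (pi _).
  by apply/seteqP; split=> t /=; tauto.
- move=> A mA; have [<- _] := cpi _ mA; congr (pi _).
  by apply/seteqP; split=> t /=; tauto.
Qed.

(** The triangle inequality and the Lipschitz bounds concern the root, whereas [SW] integrates the
    power. Infinite values are kept until finiteness is proved. *)
Definition wass p a b : \bar R := (Wpp p a b `^ p^-1)%E.

Lemma wass_ge0 p a b : (0 <= wass p a b)%E.
Proof. exact: poweR_ge0. Qed.

Lemma wass_poweR p a b : p != 0 -> (wass p a b `^ p)%E = Wpp p a b.
Proof. by move=> p0; rewrite /wass -poweRrM mulVf// poweRe1// Wpp_ge0. Qed.

Lemma LnormB_poweR d (T : measurableType d) (P : {measure set T -> \bar R})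
    (U V : T -> R) p :
  ('N[P]_p%:E[EFin \o (U \- V)%R])%E =
  ((\int[P]_t (`|U t - V t| `^ p)%:E) `^ p^-1)%E.
Proof. by rewrite unlock. Qed.

Lemma wass_le_joint d (T : measurableType d) (P : probability T R)
    (U V : T -> R) a b p : 0 <= p ->
  measurable_fun setT U -> measurable_fun setT V ->
  (forall A, measurable A -> a A = P (U @^-1` A)) ->
  (forall A, measurable A -> b A = P (V @^-1` A)) ->
  (wass p a b <= 'N[P]_p%:E[EFin \o (U \- V)%R])%E.
Proof.
move=> p0 mU mV aE bE; rewrite LnormB_poweR; apply: gt0_ler_poweR.
- by rewrite invr_ge0.
- by rewrite in_itv/= Wpp_ge0 leey.
- by rewrite in_itv/= leey andbT; apply: integral_ge0 => z _; rewrite lee_fin powR_ge0.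
- exact: Wpp_le_joint.
Qed.

(** A strict bound on the infimum yields a near-optimal plan, so the existence of an optimal one
    never enters. *)
Lemma wass_lt_coupling p a b (x : R) : 0 < p -> (wass p a b < x%:E)%E ->
  exists2 pi : probability (R * R)%type R, coupling a b pi &
    ('N[pi]_p%:E[EFin \o (fst \- snd)%R] <= x%:E)%E.
Proof.
move=> p0 wx.
have x0 : 0 <= x by rewrite -lee_fin (le_trans (wass_ge0 p a b))// ltW.
have /ereal_inf_lt[_ [pi /= cpi <-] pix] : (Wpp p a b < (x `^ p)%:E)%E.
  rewrite -wass_poweR ?gt_eqF//.
  have /fineK <- : wass p a b \is a fin_num.
    by rewrite ge0_fin_numE ?wass_ge0// (lt_le_trans wx)// leey.
  rewrite poweR_EFin lte_fin gt0_ltr_powR// ?nnegrE ?fine_ge0 ?wass_ge0//.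
  by rewrite -lte_fin fineK// ge0_fin_numE ?wass_ge0// (lt_le_trans wx)// leey.
exists pi => //; rewrite LnormB_poweR.
have -> : x%:E = ((x `^ p)%:E `^ p^-1)%E.
  by rewrite poweR_EFin -powRrM mulfV ?gt_eqF// powRr1.
apply: gt0_ler_poweR.
- by rewrite invr_ge0 ltW.
- by rewrite in_itv/= leey andbT; apply: integral_ge0 => z _; rewrite lee_fin powR_ge0.
- by rewrite in_itv/= lee_fin powR_ge0 leey.
- exact: ltW.
Qed.

End wasserstein.

(** * Gluing of plans *)

Section gluing.
Context {R : realType}.

Lemma countable_cells (e : R) : 0 < e -> exists F : (set R)^nat,
  [/\ forall k, measurable (F k), trivIset setT F, \bigcup_k F k = setT &
      forall k x y, F k x -> F k y -> `|x - y| <= e].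
Proof.
move=> e0.
(* Half-open intervals of length [e], indexed by the integers through their encoding in [nat]. An
   index that encodes nothing gets the empty cell. *)
pose G k : set R := if @unpickle int k is Some m
  then `[m%:~R * e, (m + 1)%:~R * e[%classic else set0.
have mG k : measurable (G k).
  by rewrite /G; case: unpickle => [m|]; [exact: measurable_itv|exact: measurable0].
(* Removing the earlier cells makes the family disjoint without comparing codes, and keeps the
   union. *)
exists (seqDU G); split.
- move=> k; apply: measurableD => //.
  by apply: bigsetU_measurable => i _.
- exact: trivIset_seqDU.
- rewrite -seqDU_bigcup_eq; apply/seteqP; split=> // x _.
  exists (pickle (Num.floor (x / e))) => //; rewrite /G pickleK/= in_itv/=.
  have /andP[h1 h2] := floor_itv (x / e).
  by rewrite -ler_pdivlMr// h1 -ltr_pdivrMr.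
- move=> k x y [+ _] [+ _]; rewrite /G; case: unpickle => [m|//].
  rewrite /= !in_itv/= intrD mulrDl mul1r => /andP[x1 x2] /andP[y1 y2].
  by rewrite ler_norml; apply/andP; split; lra.
Qed.

Section glue.
Context d1 d2 (T1 : measurableType d1) (T2 : measurableType d2).
Variables (P1 : probability T1 R) (P2 : probability T2 R).
Variables (Z1 : T1 -> R) (Z2 : T2 -> R) (F : (set R)^nat).
Hypotheses (mZ1 : measurable_fun setT Z1) (mZ2 : measurable_fun setT Z2).
Hypothesis (eqZ : forall A, measurable A -> P1 (Z1 @^-1` A) = P2 (Z2 @^-1` A)).
Hypotheses (mF : forall k, measurable (F k)) (tF : trivIset setT F).
Hypothesis (UF : \bigcup_k F k = setT).

Let mZ1F k : measurable (Z1 @^-1` F k).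
Proof. by rewrite -[X in measurable X]setTI; exact: mZ1. Qed.

Let mZ2F k : measurable (Z2 @^-1` F k).
Proof. by rewrite -[X in measurable X]setTI; exact: mZ2. Qed.

Let mcell k : measurable ((Z1 @^-1` F k) `*` (Z2 @^-1` F k)).
Proof. exact: measurableX. Qed.

Let wgt_ge0 k : 0 <= (fine (P1 (Z1 @^-1` F k)))^-1.
Proof. by rewrite invr_ge0 fine_ge0. Qed.

Let wgt k : {nonneg R} := NngNum (wgt_ge0 k).

(* The two measures are independent conditionally on the common cell of [Z1] and [Z2]. *)
Definition glued : set (T1 * T2) -> \bar R :=
  mseries (fun k => mscale (wgt k) (mrestr (P1 \x P2)%E (mcell k))) 0.

HB.instance Definition _ := Measure.on glued.

(** The weight cancels the mass of the cell. On a null cell the weight is the inverse of 0, that is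
    0, but then [x] vanishes too. *)
Let cell_term k (x : \bar R) : (0 <= x)%E -> (x <= P1 (Z1 @^-1` F k))%E ->
  ((wgt k)%:num%:E * (x * P1 (Z1 @^-1` F k)) = x)%E.
Proof.
rewrite /=; set c := P1 _ => x0 xc.
have cfin : c \is a fin_num by exact: fin_num_measure.
have xfin : x \is a fin_num by rewrite ge0_fin_numE// (le_lt_trans xc)// ltey_eq cfin.
rewrite -(fineK cfin) -(fineK xfin) -!EFinM; congr EFin.
have [c0|c0] := eqVneq (fine c) 0; last by rewrite mulrC mulfK.
have : fine x <= 0 by rewrite -c0 fine_le.
by rewrite c0 mulr0 mulr0 => fx0; apply/eqP; rewrite eq_le fx0 andbT fine_ge0.
Qed.

(** Cut [A] along the cells of [Z1]. In cell [k] the product measure gives the mass of that piece of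
    [A] times the [P2]-mass of the cell, which by [eqZ] is its [P1]-mass and is cancelled by the
    weight. *)
Lemma glued_fst A : measurable A -> glued (fst @^-1` A) = P1 A.
Proof.
move=> mA.
have -> : P1 A = (\sum_(0 <= k <oo) P1 (A `&` Z1 @^-1` F k))%E.
  rewrite -[in LHS](setIT A) -(preimage_setT Z1) -UF preimage_bigcup setI_bigcupr.
  apply: measure_semi_bigcup.
  - by move=> k; exact: measurableI.
  - apply/trivIsetP => i j _ _ ij; rewrite setIACA -[X in _ `&` X]preimage_setI.
    by move/trivIsetP : tF => /(_ _ _ I I ij) ->; rewrite preimage_set0 setI0.
  - by apply: bigcup_measurable => k _; exact: measurableI.
apply: eq_eseriesr => k _.
transitivity ((wgt k)%:num%:E * (P1 \x P2) ((A `&` Z1 @^-1` F k) `*` (Z2 @^-1` F k)))%E.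
  by congr (_ * (P1 \x P2)%E _)%E; apply/seteqP; split=> -[x y] /=; tauto.
rewrite product_measure1E//; last exact: measurableI.
rewrite -[X in (_ * (_ * X))%E](eqZ (mF k)); apply: cell_term => //.
by apply: le_measure; [rewrite inE; exact: measurableI|rewrite inE|exact: subIsetr].
Qed.

Lemma glued_snd A : measurable A -> glued (snd @^-1` A) = P2 A.
Proof.
move=> mA.
have -> : P2 A = (\sum_(0 <= k <oo) P2 (A `&` Z2 @^-1` F k))%E.
  rewrite -[in LHS](setIT A) -(preimage_setT Z2) -UF preimage_bigcup setI_bigcupr.
  apply: measure_semi_bigcup.
  - by move=> k; exact: measurableI.
  - apply/trivIsetP => i j _ _ ij; rewrite setIACA -[X in _ `&` X]preimage_setI.
    by move/trivIsetP : tF => /(_ _ _ I I ij) ->; rewrite preimage_set0 setI0.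
  - by apply: bigcup_measurable => k _; exact: measurableI.
apply: eq_eseriesr => k _.
transitivity ((wgt k)%:num%:E * (P1 \x P2) ((Z1 @^-1` F k) `*` (A `&` Z2 @^-1` F k)))%E.
  by congr (_ * (P1 \x P2)%E _)%E; apply/seteqP; split=> -[x y] /=; tauto.
rewrite product_measure1E//; last exact: measurableI.
rewrite [X in (_ * X)%E]muleC; apply: cell_term => //.
by rewrite (eqZ (mF k)); apply: le_measure;
  [rewrite inE; exact: measurableI|rewrite inE|exact: subIsetr].
Qed.

Let glued_setT : glued setT = 1%E.
Proof. by rewrite -(preimage_setT fst) glued_fst// probability_setT. Qed.

HB.instance Definition _ := Measure_isProbability.Build _ _ _ glued glued_setT.

Lemma glued_off_cells B : (forall k, B `&` ((Z1 @^-1` F k) `*` (Z2 @^-1` F k)) = set0) ->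
  glued B = 0%E.
Proof.
move=> B0; rewrite /glued /mseries eseries0// => k _ _.
transitivity ((wgt k)%:num%:E * (P1 \x P2) set0)%E; last by rewrite measure0 mule0.
by congr (_ * (P1 \x P2)%E _)%E; exact: B0.
Qed.

Definition glued_probability : probability (T1 * T2)%type R := glued.

End glue.

Lemma gluing d1 d2 (T1 : measurableType d1) (T2 : measurableType d2)
    (P1 : probability T1 R) (P2 : probability T2 R) (Z1 : T1 -> R) (Z2 : T2 -> R)
    (e : R) : 0 < e ->
  measurable_fun setT Z1 -> measurable_fun setT Z2 ->
  (forall A, measurable A -> P1 (Z1 @^-1` A) = P2 (Z2 @^-1` A)) ->
  exists M : probability (T1 * T2)%type R,
    [/\ forall A, measurable A -> M (fst @^-1` A) = P1 A,
        forall A, measurable A -> M (snd @^-1` A) = P2 A &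
        {ae M, forall w, `|Z1 w.1 - Z2 w.2| <= e}].
Proof.
move=> e0 mZ1 mZ2 eqZ; have [F [mF tF UF dF]] := countable_cells e0.
exists (glued_probability mZ1 mZ2 eqZ mF tF UF); split.
- exact: glued_fst.
- exact: glued_snd.
- exists [set w | e < `|Z1 w.1 - Z2 w.2|]; split.
  + rewrite -[X in measurable X]setTI.
    have mf : measurable_fun setT (fun w : T1 * T2 => `|Z1 w.1 - Z2 w.2|).
      apply: (measurableT_comp (@normr_measurable _ setT)); apply: measurable_funB.
      * exact: (measurableT_comp mZ1 measurable_fst).
      * exact: (measurableT_comp mZ2 measurable_snd).
    have := mf measurableT _ (measurable_itv `]e, +oo[).
    by congr measurable; apply/seteqP; split=> w /=; rewrite in_itv/= andbT.
  (* Two values in a common cell differ by at most [e], so the exceptional set meets no product of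
     matching cells. *)
  + apply: glued_off_cells => k; rewrite -subset0 => -[x y] /= [h [h1 h2]].
    by move: h; rewrite ltNge (dF _ _ _ h1 h2).
  + by move=> w /= /negP; rewrite -ltNge.
Qed.

End gluing.

(** * Triangle inequality for the Wasserstein distance on the line *)

Section triangle.
Context {R : realType}.
Implicit Types (a b c : set R -> \bar R) (p : R).

(** Lets the cost of each of the two plans be computed on the glued space, with [phi] the projection
    onto that plan. *)
Lemma Lnorm_pushforward d (T : measurableType d) (M : probability T R)
    (phi : T -> R * R) (P : probability (R * R)%type R) p :
  measurable_fun setT phi ->
  (forall A, measurable A -> M (phi @^-1` A) = P A) ->
  ('N[M]_p%:E[EFin \o ((fst \o phi) \- (snd \o phi))%R])%E =
  ('N[P]_p%:E[EFin \o (fst \- snd)%R])%E.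
Proof.
move=> mphi MP; rewrite !LnormB_poweR; congr (_ `^ _)%E.
have mc := measurable_fun_cost p (@measurable_fst _ _ R R) measurable_snd.
rewrite -[LHS](@ge0_integral_pushforward _ _ _ _ _ _ mphi M setT
  (fun z => (`|z.1 - z.2| `^ p)%:E) measurableT mc); last first.
  by move=> z _; rewrite lee_fin powR_ge0.
by apply: eq_measure_integral => A mA _; exact: MP.
Qed.

Lemma Lnorm_ae_le_cst d (T : measurableType d) (P : probability T R)
    (f : T -> R) (e p : R) : 0 < p -> 0 <= e -> measurable_fun setT f ->
  {ae P, forall t, `|f t| <= e} -> ('N[P]_p%:E[EFin \o f] <= e%:E)%E.
Proof.
move=> p0 e0 mf fe; rewrite unlock/=.
have -> : e%:E = ((e `^ p)%:E `^ p^-1)%E.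
  by rewrite poweR_EFin -powRrM mulfV ?gt_eqF// powRr1.
have mfp : measurable_fun setT (fun t => (`|f t| `^ p)%:E).
  apply/measurable_EFinP; apply: (measurableT_comp (measurable_powR p)).
  exact: (measurableT_comp (@normr_measurable _ setT)).
apply: gt0_ler_poweR.
- by rewrite invr_ge0 ltW.
- by rewrite in_itv/= leey andbT; apply: integral_ge0 => z _; rewrite lee_fin powR_ge0.
- by rewrite in_itv/= lee_fin powR_ge0 leey.
- rewrite -[leRHS]mule1 -(probability_setT P) -integral_cst//.
  apply: ae_ge0_le_integral => //.
  + by move=> z _; rewrite lee_fin powR_ge0.
  + move: fe; apply: filterS => t te _.
    by rewrite lee_fin ge0_ler_powR ?nnegrE// ltW.
Qed.

(* Near-optimal plans are glued only up to cells of diameter [d]; all errors vanish with [d]. *)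
Lemma wass_triangle p a b c : 1 <= p ->
  (wass p a b <= wass p a c + wass p c b)%E.
Proof.
move=> p1; have p0 : 0 < p by exact: lt_le_trans p1.
have [acy|acfin] := eqVneq (wass p a c) +oo%E.
  by rewrite acy addye ?leey// gt_eqF// (lt_le_trans _ (wass_ge0 _ _ _)).
have [cby|cbfin] := eqVneq (wass p c b) +oo%E.
  by rewrite cby addey ?leey// gt_eqF// (lt_le_trans _ (wass_ge0 _ _ _)).
have {}acfin : wass p a c \is a fin_num by rewrite ge0_fin_numE ?wass_ge0// ltey.
have {}cbfin : wass p c b \is a fin_num by rewrite ge0_fin_numE ?wass_ge0// ltey.
(* Three errors are to be paid: one for each near-optimal plan and one for the diameter of the
   cells. *)
apply/lee_addgt0Pr => e e0; pose d := e / 3.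
have d0 : 0 < d by rewrite divr_gt0.
have [|P1 cP1 P1d] := @wass_lt_coupling _ p a c (fine (wass p a c) + d) p0.
  by rewrite EFinD fineK// lteDl.
have [|P2 cP2 P2d] := @wass_lt_coupling _ p c b (fine (wass p c b) + d) p0.
  by rewrite EFinD fineK// lteDl.
have [|A mA|M [M1 M2 Mae]] := @gluing R _ _ _ _ P1 P2 snd fst d d0 measurable_snd.
- exact: measurable_fst.
- have [_ h1] := cP1 _ mA; have [h2 _] := cP2 _ mA.
  transitivity (c A); [rewrite -h1; congr (P1 _)|rewrite -h2; congr (P2 _)];
    by apply/seteqP; split=> t /=; tauto.
(* [U] and [V] have the outer laws [a] and [b]; [Z1] and [Z2] are two copies of the middle variable
   of law [c], almost surely within [d] of each other. *)
pose U (w : (R * R) * (R * R)) := w.1.1.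
pose V (w : (R * R) * (R * R)) := w.2.2.
pose Z1 (w : (R * R) * (R * R)) := w.1.2.
pose Z2 (w : (R * R) * (R * R)) := w.2.1.
have mU : measurable_fun setT U by exact: (measurableT_comp measurable_fst measurable_fst).
have mZ1 : measurable_fun setT Z1 by exact: (measurableT_comp measurable_snd measurable_fst).
have mZ2 : measurable_fun setT Z2 by exact: (measurableT_comp measurable_fst measurable_snd).
have mV : measurable_fun setT V by exact: (measurableT_comp measurable_snd measurable_snd).
apply: (@le_trans _ _ ('N[M]_p%:E[EFin \o (U \- V)%R])%E).
  apply: wass_le_joint => //; first exact: ltW.
  - move=> A mA; have [<- _] := cP1 _ mA; rewrite -M1; last exact: measurableX.
    by congr (M _); apply/seteqP; split=> t /=; tauto.
  - move=> A mA; have [_ <-] := cP2 _ mA; rewrite -M2; last exact: measurableX.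
    by congr (M _); apply/seteqP; split=> t /=; tauto.
have -> : (U \- V)%R = ((U \- Z1) \+ ((Z1 \- Z2) \+ (Z2 \- V)))%R.
  by apply/funext => w /=; ring.
have mUZ := measurable_funB mU mZ1.
have mZZ := measurable_funB mZ1 mZ2.
have mZV := measurable_funB mZ2 mV.
apply: (le_trans (minkowski_EFin M mUZ (measurable_funD mZZ mZV) p1)).
have -> : (wass p a c + wass p c b + e%:E =
    (fine (wass p a c) + d)%:E + (d%:E + (fine (wass p c b) + d)%:E))%E.
  rewrite -{1}(fineK acfin) -{1}(fineK cbfin) -!EFinD; congr EFin.
  by rewrite /d; field.
apply: leeD.
  by rewrite -(Lnorm_pushforward p measurable_fst M1) in P1d.
apply: (le_trans (minkowski_EFin M mZZ mZV p1)).
apply: leeD.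
  by apply: Lnorm_ae_le_cst => //; exact: ltW.
by rewrite -(Lnorm_pushforward p measurable_snd M2) in P2d.
Qed.

End triangle.

(** * Inner products and Borel sets *)

Section inner_product.
Context {R : realType} {X : normedModType R} {ip : X -> X -> R}.
Hypothesis Hip : is_inner_product ip.

Lemma ipC x y : ip x y = ip y x.
Proof. by have [h _ _] := Hip; exact: h. Qed.

Lemma ipDl x y z : ip (x + y) z = ip x z + ip y z.
Proof. by have [_ h _] := Hip; have := h 1 x y z; rewrite scale1r mul1r. Qed.

Lemma ip0l z : ip 0 z = 0.
Proof. by have := ipDl 0 0 z; rewrite addr0; lra. Qed.

Lemma ipZl r x z : ip (r *: x) z = r * ip x z.
Proof. by have [_ h _] := Hip; have := h r x 0 z; rewrite addr0 ip0l addr0. Qed.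

Lemma ipBl x y z : ip (x - y) z = ip x z - ip y z.
Proof. by rewrite ipDl -scaleN1r ipZl mulN1r. Qed.

Lemma ipBr x y z : ip x (y - z) = ip x y - ip x z.
Proof. by rewrite ipC ipBl ipC (ipC z). Qed.

Lemma ipxx x : ip x x = `|x| ^+ 2.
Proof. by have [_ _ h] := Hip; exact: h. Qed.

Lemma ip_cauchy_schwarz x y : `|ip x y| <= `|x| * `|y|.
Proof.
have [->|x0] := eqVneq x 0; first by rewrite ip0l !normr0 mul0r.
have [->|y0] := eqVneq y 0; first by rewrite ipC ip0l !normr0 mulr0.
have xy0 : 0 < `|x| * `|y| by rewrite mulr_gt0 ?normr_gt0.
(* The one-sided bound, applied to [y] and to [- y], gives the absolute value. *)
suff H (z : X) : `|z| = `|y| -> ip x z <= `|x| * `|y|.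
  have ipNr : ip x (- y) = - ip x y by rewrite -(sub0r y) ipBr (ipC x 0) ip0l sub0r.
  by rewrite ler_norml H// andbT lerNl -ipNr H// normrN.
move=> zy.
(* With [z] of the norm of [y], this square expands to twice the product of the norms times the
   wanted difference. *)
have : 0 <= ip (`|y| *: x - `|x| *: z) (`|y| *: x - `|x| *: z).
  by rewrite ipxx sqr_ge0.
rewrite ipBl !ipBr !ipZl !(ipC _ (_ *: _)) !ipZl !ipxx zy (ipC z x) => h.
suff : 0 <= (`|x| * `|y|) * (`|x| * `|y| - ip x z).
  by rewrite pmulr_rge0// subr_ge0.
by nra.
Qed.

End inner_product.

Section borel.
Context {R : realType} {X : normedModType R}.

Lemma lipschitz_continuous (f : X -> R) (L : R) :
  (forall x y, `|f x - f y| <= L * `|x - y|) -> continuous f.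
Proof.
move=> fL x; apply/cvgrPdist_le => e e0.
near=> y; apply: (le_trans (fL x y)).
have L0 : 0 < `|L| + 1 by rewrite ltr_wpDl.
apply: (@le_trans _ _ ((`|L| + 1) * `|x - y|)).
  by rewrite ler_wpM2r// (le_trans (ler_norm _))// lerDl.
rewrite mulrC -ler_pdivlMr//; near: y.
by apply: (@cvgr_dist_le _ _ _ _ _ id x); [exact: cvg_id|rewrite divr_gt0].
Unshelve. all: by end_near. Qed.

Lemma borel_open (A : set X) : open A -> measurable (A : set (borelX X)).
Proof. exact: sub_sigma_algebra. Qed.

Lemma measurable_continuous (f : X -> R) : continuous f ->
  measurable_fun [set: borelX X] (f : borelX X -> R).
Proof.
move=> cf; apply: (measurability _ (RGenOpens.measurableE R)).
move=> _ [_ [a [b ->] <-]]; rewrite setTI; apply: borel_open.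
by apply: open_comp => [x _|]; [exact: cf|exact: interval_open].
Qed.

Lemma measurable_lipschitz (f : X -> R) (L : R) :
  (forall x y, `|f x - f y| <= L * `|x - y|) ->
  measurable_fun [set: borelX X] (f : borelX X -> R).
Proof. by move=> /lipschitz_continuous; exact: measurable_continuous. Qed.

Lemma measurable_nrm : measurable_fun [set: borelX X] (@nrm R X).
Proof. by apply: (@measurable_lipschitz _ 1) => x y; rewrite mul1r ler_dist_dist. Qed.

Lemma measurable_sphere : measurable (@sphere R X).
Proof.
have -> : @sphere R X = setT `&` (@nrm R X) @^-1` [set 1] by rewrite setTI.
exact: measurable_nrm.
Qed.

Lemma measurable_proj (ip : X -> X -> R) (Hip : is_inner_product ip) (t : X) :
  measurable_fun [set: borelX X] (Defs.proj ip t).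
Proof.
apply: (@measurable_lipschitz _ `|t|) => x y.
by rewrite -ipBr//; exact: ip_cauchy_schwarz.
Qed.

End borel.

(** * Lipschitz dependence on the direction *)

Section projections.
Context {R : realType} {X : normedModType R} {ip : X -> X -> R}.
Hypothesis Hip : is_inner_product ip.
Context (p : R) (hp : 1 <= p).

Let p0 : 0 < p. Proof. exact: lt_le_trans hp. Qed.

Lemma Lnorm_le_scale d (T : measurableType d) (P : {measure set T -> \bar R})
    (f g : T -> R) (c : R) : 0 <= c -> measurable_fun setT f -> measurable_fun setT g ->
  (forall t, `|f t| <= c * `|g t|) ->
  ('N[P]_p%:E[EFin \o f] <= c%:E * 'N[P]_p%:E[EFin \o g])%E.
Proof.
move=> c0 mf mg fg; rewrite unlock/=.
have mpow (h : T -> R) : measurable_fun setT h ->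
    measurable_fun setT (fun t => (`|h t| `^ p)%:E).
  move=> mh; apply/measurable_EFinP; apply: (measurableT_comp (measurable_powR p)).
  exact: (measurableT_comp (@normr_measurable _ setT)).
have I0 (h : T -> R) : (0 <= \int[P]_t (`|h t| `^ p)%:E)%E.
  by apply: integral_ge0 => t _; rewrite lee_fin powR_ge0.
have -> : c%:E = ((c `^ p)%:E `^ p^-1)%E.
  by rewrite poweR_EFin -powRrM mulfV ?gt_eqF// powRr1.
rewrite -poweRM//; last by rewrite lee_fin powR_ge0.
apply: gt0_ler_poweR.
- by rewrite invr_ge0 ltW.
- by rewrite in_itv/= leey andbT; exact: I0.
- by rewrite in_itv/= leey andbT; apply: mule_ge0; [rewrite lee_fin powR_ge0|exact: I0].
- rewrite -(ge0_integralZl_EFin P measurableT _ (mpow _ mg) (powR_ge0 c p)); last first.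
    by move=> t _; rewrite lee_fin powR_ge0.
  apply: ge0_le_integral => //.
  + exact: mpow.
  + by apply: emeasurable_funM => //; exact: mpow.
  + move=> t _; rewrite -EFinM lee_fin -powRM// ge0_ler_powR ?nnegrE//.
    * exact: ltW.
    * exact: mulr_ge0.
Qed.

Lemma Lnorm_nrm_lty (mu : probability (borelX X) R) : in_Pp p mu ->
  ('N[mu]_p%:E[EFin \o @nrm R X] < +oo)%E.
Proof.
move=> h; rewrite unlock/=; apply: poweR_lty.
by under eq_integral do rewrite /nrm normr_id.
Qed.

Definition moment (mu : probability (borelX X) R) : R :=
  fine ('N[mu]_p%:E[EFin \o @nrm R X])%E.

Lemma moment_ge0 (mu : probability (borelX X) R) : 0 <= moment mu.
Proof. by rewrite fine_ge0// Lnorm_ge0. Qed.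

(** Both projections are variables on the same space under [mu], and by Cauchy-Schwarz they differ
    at [x] by at most the norm of [s - t] times that of [x]. *)
Lemma wass_proj_le (mu : probability (borelX X) R) (s t : X) : in_Pp p mu ->
  (wass p (proj_push ip mu s) (proj_push ip mu t) <= (`|s - t| * moment mu)%:E)%E.
Proof.
move=> muP.
have ms := measurable_proj Hip s; have mt := measurable_proj Hip t.
apply: (@le_trans _ _ ('N[mu]_p%:E[EFin \o (Defs.proj ip s \- Defs.proj ip t)%R])%E).
  by apply: wass_le_joint => //; exact: ltW.
rewrite EFinM fineK; last by rewrite ge0_fin_numE ?Lnorm_ge0// Lnorm_nrm_lty.
apply: Lnorm_le_scale => //.
- exact: measurable_funB.
- exact: measurable_nrm.
- move=> x; rewrite /= /Defs.proj -ipBl// /nrm normr_id.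
  exact: ip_cauchy_schwarz.
Qed.

Lemma wass_eq0 d (T : measurableType d) (P : probability T R) (U : T -> R)
    (a b : set R -> \bar R) : measurable_fun setT U ->
  (forall A, measurable A -> a A = P (U @^-1` A)) ->
  (forall A, measurable A -> b A = P (U @^-1` A)) -> wass p a b = 0%E.
Proof.
move=> mU aU bU; apply/eqP; rewrite eq_le wass_ge0 andbT.
apply: (le_trans (wass_le_joint (ltW p0) mU mU aU bU)).
rewrite (_ : EFin \o _ = cst 0%E) ?Lnorm0//; last by apply/funext => t/=; rewrite subrr.
by rewrite eqe gt_eqF.
Qed.

(** In the direction 0 every probability projects to the Dirac mass at 0. This is the common point
    through which [mu] and [nu] are compared in [wass_proj_fin]. *)
Lemma wass_proj0 (mu nu : probability (borelX X) R) :
  wass p (proj_push ip mu 0) (proj_push ip nu 0) = 0%E.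
Proof.
apply: (@wass_eq0 _ _ mu (Defs.proj ip 0)) => //; first exact: measurable_proj.
move=> A mA; rewrite /proj_push.
have -> : Defs.proj ip 0 = cst 0 by apply/funext => x; exact: ip0l.
rewrite preimage_cst; case: ifP => _; last by rewrite !measure0.
by rewrite [LHS]probability_setT; apply/esym; exact: probability_setT.
Qed.

Lemma wass_proj_fin (mu nu : probability (borelX X) R) (t : X) :
  in_Pp p mu -> in_Pp p nu ->
  (wass p (proj_push ip mu t) (proj_push ip nu t) <=
     (`|t| * (moment mu + moment nu))%:E)%E.
Proof.
move=> muP nuP; rewrite mulrDr EFinD.
apply: (le_trans (wass_triangle _ _ (proj_push ip mu 0) hp)).
apply: leeD; first by have := @wass_proj_le mu t 0 muP; rewrite subr0.
apply: (le_trans (wass_triangle _ _ (proj_push ip nu 0) hp)).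
rewrite wass_proj0 add0e.
by have := @wass_proj_le nu 0 t nuP; rewrite sub0r normrN.
Qed.

(** Real-valued form; by [wprojK] nothing is lost under the moment condition. *)
Definition wproj (mu nu : probability (borelX X) R) (t : X) : R :=
  fine (wass p (proj_push ip mu t) (proj_push ip nu t)).

Lemma wproj_ge0 (mu nu : probability (borelX X) R) t : 0 <= wproj mu nu t.
Proof. by rewrite fine_ge0// wass_ge0. Qed.

Lemma wprojK (mu nu : probability (borelX X) R) t : in_Pp p mu -> in_Pp p nu ->
  (wproj mu nu t)%:E = wass p (proj_push ip mu t) (proj_push ip nu t).
Proof.
move=> muP nuP; rewrite fineK// ge0_fin_numE ?wass_ge0//.
by rewrite (le_lt_trans (wass_proj_fin t muP nuP))// ltry.
Qed.

Lemma Wpp_wproj (mu nu : probability (borelX X) R) t : in_Pp p mu -> in_Pp p nu ->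
  Wpp p (proj_push ip mu t) (proj_push ip nu t) = (wproj mu nu t `^ p)%:E.
Proof. by move=> muP nuP; rewrite -wass_poweR ?gt_eqF// -wprojK. Qed.

Lemma wproj_le (mu nu : probability (borelX X) R) t : in_Pp p mu -> in_Pp p nu ->
  wproj mu nu t <= `|t| * (moment mu + moment nu).
Proof. by move=> muP nuP; rewrite -lee_fin wprojK//; exact: wass_proj_fin. Qed.

Lemma wproj_triangle (mu nu rho : probability (borelX X) R) t :
  in_Pp p mu -> in_Pp p nu -> in_Pp p rho ->
  wproj mu nu t <= wproj mu rho t + wproj rho nu t.
Proof.
by move=> muP nuP rhoP; rewrite -lee_fin EFinD !wprojK//; exact: wass_triangle.
Qed.

(** Pass from [mu] along [s] to [mu] along [t], then to [nu] along [t], then to [nu] along [s]: the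
    outer moves are controlled by [wass_proj_le]. Exchanging [s] and [t] gives the other side. *)
Lemma wproj_lipschitz (mu nu : probability (borelX X) R) :
  in_Pp p mu -> in_Pp p nu -> forall s t,
  `|wproj mu nu s - wproj mu nu t| <= (moment mu + moment nu) * `|s - t|.
Proof.
move=> muP nuP.
suff H s t : wproj mu nu s <= wproj mu nu t + (moment mu + moment nu) * `|s - t|.
  move=> s t; have := H t s; rewrite distrC => h1; have h2 := H s t.
  by rewrite ler_norml; apply/andP; split; lra.
rewrite -lee_fin !(EFinD, wprojK)//.
apply: (le_trans (wass_triangle _ _ (proj_push ip mu t) hp)).
rewrite mulrDl EFinD addeCA; apply: leeD.
  by rewrite mulrC; exact: wass_proj_le.
apply: (le_trans (wass_triangle _ _ (proj_push ip nu t) hp)).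
apply: leeD => //.
by rewrite mulrC distrC; exact: wass_proj_le.
Qed.

End projections.

(** * The sliced distance *)

Section sliced.
Context {R : realType} {X : normedModType R} {ip : X -> X -> R}.
Hypothesis Hip : is_inner_product ip.
Context (p : R) (hp : 1 <= p).
Context (gamma : {finite_measure set (borelX X) -> \bar R}).
Hypothesis gamma_pos : (0 < gamma (@sphere R X))%E.

Let p0 : 0 < p. Proof. exact: lt_le_trans hp. Qed.

Let S : set (borelX X) := @sphere R X.

Let gS := fine (gamma S).

Let gS_gt0 : 0 < gS.
Proof.
rewrite fine_gt0// gamma_pos/= ltey_eq fin_num_measure//; exact: measurable_sphere.
Qed.

(** Cutting off by the indicator turns the integral over the sphere into an integral over the whole
    space, where Minkowski's inequality is applied. *)
Definition wsphere (mu nu : probability (borelX X) R) (t : borelX X) : R :=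
  wproj (ip := ip) p mu nu t * \1_S t.

Lemma measurable_wproj (mu nu : probability (borelX X) R) :
  in_Pp p mu -> in_Pp p nu ->
  measurable_fun [set: borelX X] (wproj (ip := ip) p mu nu : borelX X -> R).
Proof. by move=> muP nuP; apply: measurable_lipschitz; exact: wproj_lipschitz. Qed.

Lemma measurable_wsphere (mu nu : probability (borelX X) R) :
  in_Pp p mu -> in_Pp p nu -> measurable_fun setT (wsphere mu nu).
Proof.
move=> muP nuP; have m1 : measurable_fun setT (\1_S : borelX X -> R).
  by apply: measurable_indic; exact: measurable_sphere.
exact: (measurable_funM (measurable_wproj muP nuP) m1).
Qed.

Lemma wsphere_ge0 (mu nu : probability (borelX X) R) t : 0 <= wsphere mu nu t.
Proof. by rewrite mulr_ge0 ?wproj_ge0. Qed.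

Let swcst : \bar R := (((gS)^-1)%:E `^ p^-1)%E.

Let swcst_gt0 : (0 < swcst)%E.
Proof. by apply: poweR_gt0; rewrite lte_fin invr_gt0. Qed.

Let swcst_fin : swcst \is a fin_num.
Proof. exact: fin_num_poweR. Qed.

Lemma integral_Wpp_sphere (mu nu : probability (borelX X) R) :
  in_Pp p mu -> in_Pp p nu ->
  (\int[gamma]_(t in S) Wpp p (proj_push ip mu t) (proj_push ip nu t) =
   \int[gamma]_t (`|wsphere mu nu t| `^ p)%:E)%E.
Proof.
move=> muP nuP; rewrite integral_mkcond; apply: eq_integral => t _.
rewrite patchE /wsphere indicE; case: ifPn => tS.
  by rewrite mulr1 ger0_norm ?wproj_ge0// Wpp_wproj.
by rewrite mulr0 normr0 powR0// gt_eqF.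
Qed.

(** Up to a positive finite constant the sliced distance is a norm in $L^p(\gamma)$; finiteness, the
    triangle inequality and the vanishing case all start from this form. *)
Lemma SW_Lnorm (mu nu : probability (borelX X) R) : in_Pp p mu -> in_Pp p nu ->
  SW ip p gamma mu nu = (swcst * 'N[gamma]_p%:E[EFin \o wsphere mu nu])%E.
Proof.
move=> muP nuP; rewrite /SW integral_Wpp_sphere// poweRM//.
- by rewrite unlock.
- by rewrite lee_fin invr_ge0 ltW.
- by apply: integral_ge0 => t _; rewrite lee_fin powR_ge0.
Qed.

Lemma SW_sym (mu nu : probability (borelX X) R) :
  SW ip p gamma mu nu = SW ip p gamma nu mu.
Proof. by rewrite /SW; under eq_integral do rewrite Wpp_sym. Qed.

Lemma SW_triangle (mu nu rho : probability (borelX X) R) :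
  in_Pp p mu -> in_Pp p nu -> in_Pp p rho ->
  (SW ip p gamma mu nu <= SW ip p gamma mu rho + SW ip p gamma rho nu)%E.
Proof.
move=> muP nuP rhoP; rewrite !SW_Lnorm// -ge0_muleDr ?Lnorm_ge0//.
apply: lee_wpmul2l; first exact: ltW.
have m1 := measurable_wsphere muP rhoP; have m2 := measurable_wsphere rhoP nuP.
apply: le_trans (minkowski_EFin gamma m1 m2 hp).
rewrite -[leRHS]mul1e; apply: (Lnorm_le_scale hp) => //.
- exact: measurable_wsphere.
- exact: measurable_funD.
- move=> t; rewrite mul1r !ger0_norm ?addr_ge0 ?wsphere_ge0//.
  rewrite /wsphere /= -mulrDl ler_wpM2r//.
  exact: wproj_triangle.
Qed.

Lemma SW_lty (mu nu : probability (borelX X) R) : in_Pp p mu -> in_Pp p nu ->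
  (SW ip p gamma mu nu < +oo)%E.
Proof.
move=> muP nuP; rewrite SW_Lnorm//.
set K := (moment p mu + moment p nu).
have K0 : 0 <= K by rewrite addr_ge0 ?moment_ge0.
apply: lte_mul_pinfty => //; first exact: ltW.
apply: (@le_lt_trans _ _ (K%:E * 'N[gamma]_p%:E[cst 1])%E).
  apply: (Lnorm_le_scale hp) => //; first exact: measurable_wsphere.
  move=> t; rewrite normr1 mulr1 ger0_norm ?wsphere_ge0// /wsphere indicE.
  have [|_] := boolP (t \in S); last by rewrite mulr0.
  rewrite inE mulr1 => tS; have := wproj_le Hip hp t muP nuP.
  by rewrite (_ : `|t| = 1)// mul1r.
rewrite Lnorm_cst1; apply: lte_mul_pinfty; rewrite ?lee_fin//.
by apply: poweR_lty; rewrite ltey_eq fin_num_measure.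
Qed.

Lemma SW_eq0_of_eq (mu nu : probability (borelX X) R) :
  (forall A : set (borelX X), measurable A -> mu A = nu A) ->
  SW ip p gamma mu nu = 0%E.
Proof.
move=> munu; rewrite /SW.
under eq_integral => t _.
  rewrite -(@wass_poweR _ p) ?gt_eqF//.
  rewrite (@wass_eq0 _ p hp _ _ mu (Defs.proj ip t)); last 3 first.
  - exact: measurable_proj.
  - by [].
  - move=> A mA; rewrite munu// -[X in measurable X]setTI.
    exact: measurable_proj.
  rewrite poweR0r ?gt_eqF//.
  over.
by rewrite integral0 mule0 poweR0r// invr_eq0 gt_eqF.
Qed.

Hypothesis gamma_strict : forall O : set X, open O ->
  (@sphere R X `&` O) !=set0 -> (0 < gamma (@sphere R X `&` O))%E.

(* By continuity of [wproj], a positive value on the sphere persists on an open set,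
   which [gamma] charges. *)
Lemma SW_eq0_wproj (mu nu : probability (borelX X) R) : in_Pp p mu -> in_Pp p nu ->
  SW ip p gamma mu nu = 0%E -> forall t : X, `|t| = 1 ->
  wproj (ip := ip) p mu nu t = 0.
Proof.
move=> muP nuP SW0 t t1.
apply/eqP; rewrite eq_le wproj_ge0 andbT leNgt; apply/negP => ft0.
set f := wproj (ip := ip) p mu nu in ft0 *.
(* On [O] the integrand is at least the [p]-th power of half the value at [t], a positive
   constant. *)
pose O : set X := f @^-1` `](f t / 2), +oo[%classic.
have oO : open O.
  apply: open_comp => [x _|]; last exact: interval_open.
  exact: (lipschitz_continuous (wproj_lipschitz Hip hp muP nuP)).
have gSO : (0 < gamma (S `&` O))%E.
  apply: gamma_strict => //; exists t; split => //=.
  by rewrite /O/= in_itv/= andbT; lra.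
have mSO : measurable (S `&` O : set (borelX X)).
  by apply: measurableI; [exact: measurable_sphere|exact: borel_open].
have : (0 < \int[gamma]_x (`|wsphere mu nu x| `^ p)%:E)%E.
  apply: (@lt_le_trans _ _ (\int[gamma]_(x in S `&` O) ((f t / 2) `^ p)%:E)%E).
    rewrite integral_cst//; apply: mule_gt0 => //.
    by rewrite lte_fin powR_gt0// divr_gt0.
  have mw := measurable_wsphere muP nuP.
  have mwp : measurable_fun setT (fun x => (`|wsphere mu nu x| `^ p)%:E).
    apply/measurable_EFinP; apply: (measurableT_comp (measurable_powR p)).
    exact: (measurableT_comp (@normr_measurable _ setT)).
  apply: (@le_trans _ _ (\int[gamma]_(x in S `&` O) (`|wsphere mu nu x| `^ p)%:E)%E).
    apply: ge0_le_integral => //.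
    - by move=> x _; rewrite lee_fin powR_ge0.
    - exact: measurable_funTS.
    - move=> x [xS]; rewrite /O/= in_itv/= andbT => fx.
      rewrite lee_fin ge0_ler_powR ?nnegrE//; [exact: ltW|by rewrite divr_ge0// ltW|].
      rewrite /wsphere indicE mem_set// mulr1 ger0_norm ?wproj_ge0//.
      exact: ltW.
  by apply: ge0_subset_integral => // x _; rewrite lee_fin powR_ge0.
move: SW0; rewrite SW_Lnorm// => /eqP.
rewrite mule_eq0 gt_eqF//= => /eqP N0.
have <- := @poweR_Lnorm _ _ _ gamma (EFin \o wsphere mu nu) _ (lt0r_neq0 p0).
by rewrite N0 poweR0r ?gt_eqF// ltxx.
Qed.

End sliced.

(** * Cosine integrals *)

Section cosine_integrals.
Context {R : realType}.

Lemma cos_lipschitz (x y : R) : `|cos x - cos y| <= `|x - y|.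
Proof.
suff H (a b : R) : a <= b -> `|cos a - cos b| <= `|a - b|.
  have [xy|/ltW yx] := leP x y; first exact: H.
  by rewrite distrC (distrC x); exact: H.
move=> ab.
have [|c _] := @MVT_segment R cos (fun x => - sin x) a b ab.
  by apply: continuous_subspaceT => z; exact: continuous_cos.
rewrite distrC (distrC a) => ->.
by rewrite normrM normrN ler_piMl// sin_max.
Qed.

Lemma integrable_bounded d (T : measurableType d) (P : probability T R)
    (f : T -> R) (M : R) : measurable_fun setT f -> (forall t, `|f t| <= M) ->
  P.-integrable setT (EFin \o f).
Proof.
move=> mf fM; apply: measurable_bounded_integrable => //.
  by rewrite (le_lt_trans (probability_le1 _ _))// ltry.
exists M; split; first exact: num_real.
by move=> N MN t _; apply: (le_trans (fM t)); exact: ltW.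
Qed.

(** Brings integrals living on two different spaces onto one plan in the plane, where they can be
    subtracted. *)
Lemma Rintegral_eq_law d (T : measurableType d) d' (T' : measurableType d')
    (P : probability T R) (Q : probability T' R) (U : T -> R) (V : T' -> R)
    (phi : R -> R) (M : R) :
  measurable_fun setT U -> measurable_fun setT V ->
  (forall A, measurable A -> P (U @^-1` A) = Q (V @^-1` A)) ->
  measurable_fun setT phi -> (forall u, `|phi u| <= M) ->
  (\int[P]_t phi (U t) = \int[Q]_t phi (V t))%R.
Proof.
move=> mU mV UV mphi phiM; rewrite /Rintegral; congr fine.
have mphi' : measurable_fun setT (EFin \o phi) by exact/measurable_EFinP.
have iU : P.-integrable (U @^-1` setT) ((EFin \o phi) \o U).
  apply: (@integrable_bounded _ _ P (phi \o U) M); last by move=> t; exact: phiM.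
  exact: (measurableT_comp mphi mU).
have iV : Q.-integrable (V @^-1` setT) ((EFin \o phi) \o V).
  apply: (@integrable_bounded _ _ Q (phi \o V) M); last by move=> t; exact: phiM.
  exact: (measurableT_comp mphi mV).
transitivity (\int[pushforward P U]_u (EFin \o phi) u)%E.
  by rewrite (integral_pushforward mU mphi' iU).
transitivity (\int[pushforward Q V]_u (EFin \o phi) u)%E.
  by apply: (eq_measure_integral (pushforward Q V)) => A mA _; exact: UV.
by rewrite (integral_pushforward mV mphi' iV).
Qed.

(* From [u <= e + e (u / e)^p], integrated against a coupling of cost at most [e^p]. *)
Lemma Rintegral_dist_le d (T : measurableType d) (P : probability T R)
    (f : T -> R) (p e : R) : 1 <= p -> 0 < e -> measurable_fun setT f ->
  ('N[P]_p%:E[EFin \o f] <= e%:E)%E ->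
  (\int[P]_t `|f t|%:E <= (2 * e)%:E)%E.
Proof.
move=> p1 e0 mf Nfe; have p0 : 0 < p by exact: lt_le_trans p1.
have mn : measurable_fun setT (fun t => `|f t|).
  exact: (measurableT_comp (@normr_measurable _ setT)).
have mfp : measurable_fun setT (fun t => (`|f t| `^ p)%:E).
  by apply/measurable_EFinP; apply: (measurableT_comp (measurable_powR p)).
have Ie : (\int[P]_t (`|f t| `^ p)%:E <= (e `^ p)%:E)%E.
  have -> : (\int[P]_t (`|f t| `^ p)%:E = 'N[P]_p%:E[EFin \o f] `^ p)%E.
    by rewrite poweR_Lnorm// gt_eqF.
  rewrite -poweR_EFin; apply: gt0_ler_poweR => //.
  - exact: ltW.
  - by rewrite in_itv/= Lnorm_ge0 leey.
  - by rewrite in_itv/= lee_fin ltW//= leey.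
have pw u : 0 <= u -> u <= e + e * (e^-1 `^ p * u `^ p).
  move=> u0; have [ue|eu] := leP u e.
    by rewrite (le_trans ue)// lerDl mulr_ge0 ?(ltW e0)// mulr_ge0// powR_ge0.
  rewrite -powRM ?invr_ge0 ?(ltW e0)//.
  have : e^-1 * u <= (e^-1 * u) `^ p.
    by apply: le1r_powR => //; rewrite mulrC ler_pdivlMr// mul1r ltW.
  rewrite -(ler_pM2l e0) mulrA mulfV ?gt_eqF// mul1r => /le_trans; apply.
  by rewrite lerDr ltW.
pose k := e * e^-1 `^ p.
have k0 : 0 <= k by rewrite mulr_ge0 ?powR_ge0// ltW.
apply: (@le_trans _ _ (\int[P]_t (cst e%:E t + k%:E * (`|f t| `^ p)%:E))%E).
  apply: ge0_le_integral => //.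
  - exact/measurable_EFinP.
  - apply: emeasurable_funD => //; exact: emeasurable_funM.
  - by move=> t _; rewrite -EFinM -EFinD lee_fin /k -mulrA; exact: pw.
rewrite ge0_integralD//; last 3 first.
- by move=> t _; rewrite lee_fin ltW.
- by move=> t _; rewrite -EFinM lee_fin mulr_ge0// powR_ge0.
- exact: emeasurable_funM.
rewrite integral_cst//; have -> : (e%:E * P setT = e%:E)%E by rewrite probability_setT mule1.
rewrite ge0_integralZl_EFin//.
have -> : (2 * e)%:E = (e%:E + k%:E * (e `^ p)%:E)%E.
  rewrite -EFinM -EFinD /k -mulrA -powRM ?invr_ge0 ?(ltW e0)//.
  by rewrite mulVf ?gt_eqF// powR1; congr EFin; lra.
by apply: leeD => //; apply: lee_wpmul2l.
Qed.

(** The integrand is [L]-Lipschitz in the variable, so a plan of small cost bounds the difference of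
    the two integrals by [L] times the mean distance under the plan. *)
Lemma wass_eq0_cos (a b : set R -> \bar R) (p L c : R)
    d (T : measurableType d) d' (T' : measurableType d')
    (P : probability T R) (Q : probability T' R) (U : T -> R) (V : T' -> R) :
  1 <= p -> 0 <= L -> measurable_fun setT U -> measurable_fun setT V ->
  (forall A, measurable A -> a A = P (U @^-1` A)) ->
  (forall A, measurable A -> b A = Q (V @^-1` A)) ->
  wass p a b = 0%E ->
  \int[P]_t cos (L * U t - c) = \int[Q]_t cos (L * V t - c).
Proof.
move=> p1 L0 mU mV aU bV wab; have p0 : 0 < p by exact: lt_le_trans p1.
pose phi u : R := cos (L * u - c).
have mphi : measurable_fun setT phi.
  apply: continuous_measurable_fun => u.
  apply: (@continuous_comp _ _ _ (fun u => L * u - c) cos); last exact: continuous_cos.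
  by apply: cvgB; [apply: cvgM; [exact: cvg_cst|exact: cvg_id]|exact: cvg_cst].
have phi1 u : `|phi u| <= 1 by exact: cos_max.
apply/eqP; rewrite -subr_eq0 -normr_le0; apply/ler_addgt0Pr => e e0; rewrite add0r.
have L1 : 0 < L + 1 by rewrite ltr_wpDl.
(* Chosen so that [L * (2 * e')] is at most [e]; the added 1 covers [L = 0]. *)
pose e' := e / (2 * (L + 1)).
have e'0 : 0 < e' by rewrite divr_gt0// mulr_gt0.
have [|pi cpi Npi] := @wass_lt_coupling _ p a b e' p0; first by rewrite wab lte_fin.
have -> : \int[P]_t phi (U t) = \int[pi]_z phi z.1.
  apply: (@Rintegral_eq_law _ _ _ _ P pi U fst phi 1) => // A mA.
  have [h _] := cpi _ mA; rewrite -aU// -h; congr (pi _).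
  by apply/seteqP; split=> t /=; tauto.
have -> : \int[Q]_t phi (V t) = \int[pi]_z phi z.2.
  apply: (@Rintegral_eq_law _ _ _ _ Q pi V snd phi 1) => // A mA.
  have [_ h] := cpi _ mA; rewrite -bV// -h; congr (pi _).
  by apply/seteqP; split=> t /=; tauto.
have i1 : pi.-integrable setT (EFin \o (fun z => phi z.1)).
  apply: (@integrable_bounded _ _ pi _ 1); last by move=> z; exact: phi1.
  exact: (measurableT_comp mphi measurable_fst).
have i2 : pi.-integrable setT (EFin \o (fun z => phi z.2)).
  apply: (@integrable_bounded _ _ pi _ 1); last by move=> z; exact: phi1.
  exact: (measurableT_comp mphi measurable_snd).
rewrite -RintegralB//.
have i3 : pi.-integrable setT (EFin \o (fun z => phi z.1 - phi z.2)).
  exact: (integrableB measurableT i1 i2).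
apply: (le_trans (le_normr_Rintegral measurableT i3)).
have md : measurable_fun setT (fun z : R * R => z.1 - z.2) by exact: measurable_funB.
have mnd : measurable_fun setT (fun z : R * R => `|z.1 - z.2|).
  exact: (measurableT_comp (@normr_measurable _ setT)).
have dle := Rintegral_dist_le p1 e'0 md Npi.
rewrite /Rintegral -lee_fin fineK; last first.
  have /integrableP[_] := i3; rewrite ge0_fin_numE//.
  by apply: integral_ge0 => z _; rewrite lee_fin.
apply: (@le_trans _ _ (\int[pi]_z (L%:E * `|z.1 - z.2|%:E))%E).
  apply: ge0_le_integral => //.
  - apply/measurable_EFinP; apply: (measurableT_comp (@normr_measurable _ setT)).
    by apply: measurable_funB; exact: measurableT_comp.
  - by apply: emeasurable_funM => //; exact/measurable_EFinP.
  - move=> z _; rewrite -EFinM lee_fin (le_trans (cos_lipschitz _ _))//.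
    rewrite (_ : _ - _ = L * (z.1 - z.2)); last by ring.
    by rewrite normrM ger0_norm.
rewrite ge0_integralZl_EFin//; last exact/measurable_EFinP.
apply: (@le_trans _ _ (L%:E * (2 * e')%:E)%E); first exact: lee_wpmul2l.
rewrite -EFinM lee_fin /e'.
rewrite (_ : L * _ = (L / (L + 1)) * e); last first.
  by field; rewrite gt_eqF.
by rewrite ler_piMl ?(ltW e0)// ler_pdivrMr// mul1r lerDl.
Qed.

End cosine_integrals.

(** * Polynomial approximation of a step *)

Section step_approximation.
Context {R : realType}.

Lemma bernoulli_ineq (a : R) (m : nat) : -1 <= a -> 1 + m%:R * a <= (1 + a) ^+ m.
Proof.
move=> a1; elim: m => [|m IH]; first by rewrite mul0r addr0 expr0.
rewrite exprS; apply: (@le_trans _ _ ((1 + a) * (1 + m%:R * a))).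
  have : 0 <= m%:R * (a * a) by rewrite mulr_ge0// -expr2 sqr_ge0.
  by rewrite -natr1; lra.
by apply: ler_wpM2l => //; lra.
Qed.

Lemma cvg_natr_geometric (z : R) : 0 <= z < 1 -> n%:R * z ^+ n @[n --> \oo] --> (0 : R).
Proof.
move=> /andP[]; rewrite le_eqVlt => /predU1P[<- _|z0 z1].
  apply: cvg_near_cst; near=> n.
  by rewrite expr0n gtn_eqF ?mulr0//; near: n; exact: nbhs_infty_gt.
(* Split [z ^+ n] into two factors [s ^+ n]: Bernoulli's inequality for [1 + h], the inverse of [s],
   bounds [n%:R * s ^+ n] by the inverse of [h], and the other factor tends to 0. *)
pose s := Num.sqrt z.
have s0 : 0 < s by rewrite sqrtr_gt0.
have s1 : s < 1 by rewrite -sqrtr1 ltr_sqrt.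
pose h := s^-1 - 1.
have h0 : 0 < h by rewrite subr_gt0 invf_gt1.
apply: (@squeeze_cvgr _ _ _ _ (fun=> 0) (fun n => h^-1 * s ^+ n)).
- apply: nearW => n; apply/andP; split.
    by rewrite mulr_ge0// exprn_ge0// ltW.
  have -> : z ^+ n = s ^+ n * s ^+ n by rewrite -exprMn -expr2 sqr_sqrtr// ltW.
  rewrite mulrA ler_pM2r ?exprn_gt0//.
  rewrite -ler_pdivlMr ?exprn_gt0// -exprVn ler_pdivlMl// mulrC.
  have := @bernoulli_ineq h n; rewrite addrCA subrr addr0 => H.
  by apply: (le_trans _ (H _)); lra.
- exact: cvg_cst.
- rewrite -(mulr0 h^-1); apply: cvgM; first exact: cvg_cst.
  by apply: cvg_expr; rewrite ger0_norm ?ltW.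
Unshelve. all: by end_near. Qed.

(** The power of 2 places the jump at one half. The extra factor [n] makes the limit 0 at one half
    itself, where the exponent [2 ^ n] alone would give $e^{-1}$. *)
Definition step_poly (n : nat) (x : R) : R := (1 - x ^+ n) ^+ (n * 2 ^ n).

Lemma step_poly_itv (n : nat) (x : R) : 0 <= x <= 1 -> 0 <= step_poly n x <= 1.
Proof.
move=> /andP[x0 x1]; have h0 : 0 <= x ^+ n by exact: exprn_ge0.
have h1 : x ^+ n <= 1 by exact: exprn_ile1.
by rewrite exprn_ge0 ?exprn_ile1; lra.
Qed.

(** Below one half, Bernoulli gives the lower bound [1 - n%:R * (2 * x) ^+ n], which tends to 1.
    From one half on, $(1-x^n)^m \le (1+x^n)^{-m} \le 1/(n+1)$ with $m = n2^n$. *)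
Lemma step_poly_cvg (x : R) : 0 <= x <= 1 ->
  step_poly n x @[n --> \oo] --> ((x < 2^-1)%R%:R : R).
Proof.
move=> /andP[x0 x1].
have xn0 (n : nat) : 0 <= x ^+ n by exact: exprn_ge0.
have xn1 (n : nat) : x ^+ n <= 1 by exact: exprn_ile1.
have natE (n : nat) : (n * 2 ^ n)%:R * x ^+ n = n%:R * (2 * x) ^+ n.
  by rewrite natrM natrX exprMn mulrA.
have [xlt|xge] := ltP x 2^-1.
- apply: (@squeeze_cvgr _ _ _ _ (fun n => 1 - n%:R * (2 * x) ^+ n) (fun=> 1)).
  + apply: nearW => n; have /andP[_ ->] : 0 <= step_poly n x <= 1.
      by apply: step_poly_itv; rewrite x0.
    rewrite andbT; have := @bernoulli_ineq (- x ^+ n) (n * 2 ^ n).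
    by rewrite mulrN natE lerN2 => ->.
  + rewrite -[X in _ --> X]subr0; apply: cvgB; first exact: cvg_cst.
    by apply: cvg_natr_geometric; rewrite mulr_ge0//=; lra.
  + exact: cvg_cst.
- apply: (@squeeze_cvgr _ _ _ _ (fun=> 0) harmonic).
  + apply: nearW => n; have /andP[-> _] : 0 <= step_poly n x <= 1.
      by apply: step_poly_itv; rewrite x0.
    rewrite /= /harmonic /step_poly; set m := (n * 2 ^ n)%N.
    rewrite -[leRHS]mul1r ler_pdivlMr//.
    have nm : n%:R <= m%:R * x ^+ n.
      rewrite /m natE ler_peMr// exprn_ege1//.
      by rewrite -ler_pdivrMl// mulr1.
    apply: (@le_trans _ _ ((1 - x ^+ n) ^+ m * (1 + x ^+ n) ^+ m)).
      apply: ler_wpM2l; first by rewrite exprn_ge0// subr_ge0.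
      apply: (le_trans _ (@bernoulli_ineq _ _ _)).
        by rewrite -natr1; lra.
      exact: le_trans (xn0 n).
    rewrite -exprMn exprn_ile1//.
      by rewrite mulr_ge0// ?subr_ge0// addr_ge0.
    by have := mulr_ge0 (xn0 n) (xn0 n); lra.
  + exact: cvg_cst.
  + exact: cvg_harmonic.
Qed.

End step_approximation.

(** * Measures are determined by their cosine integrals *)

Section cosine_uniqueness.
Context {R : realType} {X : normedModType R} {ip : X -> X -> R}.
Hypothesis Hip : is_inner_product ip.
Variables mu nu : probability (borelX X) R.

(** The free phase [c] includes the sines, so these functions carry the information of the
    characteristic function in real form. *)
Definition cosw (t : X) (c : R) (x : borelX X) : R := cos (ip t x - c).

Lemma measurable_cosw t c : measurable_fun setT (cosw t c).
Proof.
apply: (@measurableT_comp _ _ _ _ _ _ cos _ (fun x : borelX X => ip t x - c)).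
  by apply: continuous_measurable_fun; exact: continuous_cos.
by apply: measurable_funB => //; exact: (measurable_proj Hip t).
Qed.

Lemma cosw_le1 t c x : `|cosw t c x| <= 1.
Proof. exact: cos_max. Qed.

Lemma coswM s d t c x :
  cosw s d x * cosw t c x = 2^-1 * cosw (t + s) (c + d) x + 2^-1 * cosw (t - s) (c - d) x.
Proof.
rewrite /cosw (ipBl Hip) (ipDl Hip).
rewrite (_ : ip t x + ip s x - (c + d) = (ip t x - c) + (ip s x - d)); last by ring.
rewrite (_ : ip t x - ip s x - (c - d) = (ip t x - c) - (ip s x - d)); last by ring.
by move: (ip t x - c) (ip s x - d) => u v; rewrite cosD cosB; field.
Qed.

(** Testing [f] against every cosine, and not only by its integral, is what makes the class stable
    under multiplication by cosines, via [coswM]. *)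
Definition cos_agree (f : borelX X -> R) : Prop :=
  [/\ measurable_fun setT f, exists M, forall x, `|f x| <= M &
      forall t c, \int[mu]_x (f x * cosw t c x) = \int[nu]_x (f x * cosw t c x)].

Let integrable_cosM (P : probability (borelX X) R) (f : borelX X -> R) (t : X) (c : R) :
  measurable_fun setT f -> (exists M, forall x, `|f x| <= M) ->
  P.-integrable setT (EFin \o (fun x => f x * cosw t c x)).
Proof.
move=> mf [M fM]; apply: (@integrable_bounded _ _ _ P _ M).
  exact: (measurable_funM mf (measurable_cosw t c)).
move=> x; rewrite normrM (le_trans _ (fM x))// ler_piMr//; exact: cosw_le1.
Qed.

Lemma cos_agree_lin (a b : R) f g : cos_agree f -> cos_agree g ->
  cos_agree (fun x => a * f x + b * g x).
Proof.
move=> [mf [M fM] fE] [mg [N gN] gE]; split.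
- by apply: measurable_funD; apply: measurable_funM.
- exists (`|a| * M + `|b| * N) => x; rewrite (le_trans (ler_normD _ _))//.
  by rewrite !normrM lerD// ler_wpM2l.
- move=> t c.
  have E (P : probability (borelX X) R) : \int[P]_x ((a * f x + b * g x) * cosw t c x) =
      a * \int[P]_x (f x * cosw t c x) + b * \int[P]_x (g x * cosw t c x).
    have intf : P.-integrable setT (EFin \o (fun x => f x * cosw t c x)).
      by apply: integrable_cosM => //; exists M.
    have intg : P.-integrable setT (EFin \o (fun x => g x * cosw t c x)).
      by apply: integrable_cosM => //; exists N.
    rewrite -!RintegralZl// -RintegralD//; first by apply: eq_Rintegral => x _; ring.
    - exact: (integrableZl measurableT a intf).
    - exact: (integrableZl measurableT b intg).
  by rewrite !E fE gE.
Qed.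

Lemma cos_agree_cosw s d f : cos_agree f -> cos_agree (fun x => f x * cosw s d x).
Proof.
move=> [mf [M fM] fE]; split.
- exact: (measurable_funM mf (measurable_cosw s d)).
- exists M => x; rewrite normrM (le_trans _ (fM x))// ler_piMr//; exact: cosw_le1.
- move=> t c.
  have E (P : probability (borelX X) R) : \int[P]_x (f x * cosw s d x * cosw t c x) =
      2^-1 * \int[P]_x (f x * cosw (t + s) (c + d) x) +
      2^-1 * \int[P]_x (f x * cosw (t - s) (c - d) x).
    have intf t' c' : P.-integrable setT (EFin \o (fun x => f x * cosw t' c' x)).
      by apply: integrable_cosM => //; exists M.
    rewrite -!RintegralZl// -RintegralD//.
    - by apply: eq_Rintegral => x _; rewrite -mulrA coswM; ring.
    - exact: (integrableZl measurableT _ (intf _ _)).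
    - exact: (integrableZl measurableT _ (intf _ _)).
  by rewrite !E !fE.
Qed.

(** Dominated convergence with the constant [M], under each of the two probabilities. *)
Lemma cos_agree_cvg (f_ : (borelX X -> R)^nat) f (M : R) :
  (forall n, cos_agree (f_ n)) -> (forall n x, `|f_ n x| <= M) ->
  (forall x, f_ n x @[n --> \oo] --> f x) -> cos_agree f.
Proof.
move=> fA fM fcvg.
have mf : measurable_fun setT f.
  by apply: (@measurable_fun_cvg _ _ _ _ f_) => // n; have [] := fA n.
have fle x : `|f x| <= M.
  apply: (@closed_cvg _ _ \oo _ (fun n => `|f_ n x|) [set y | y <= M]).
  - exact: closed_le.
  - by apply: nearW => n; exact: fM.
  - by apply: cvg_norm; exact: fcvg.
split => //; first by exists M.
move=> t c.
have H (P : probability (borelX X) R) :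
    (\int[P]_x (f_ n x * cosw t c x)%:E)%E @[n --> \oo] -->
    (\int[P]_x (f x * cosw t c x)%:E)%E.
  have M0 : 0 <= M by exact: le_trans (fM 0%N point).
  apply: (@dominated_cvg _ _ _ P setT measurableT
     (fun n x => (f_ n x * cosw t c x)%:E) _ (cst M%:E)) => //.
  - move=> n; apply/measurable_EFinP; have [mfn _ _] := fA n.
    exact: (measurable_funM mfn (measurable_cosw t c)).
  - move=> x _; apply: cvg_EFin; first by apply: nearW.
    by apply: cvgM; [exact: fcvg|exact: cvg_cst].
  - apply: (@integrable_bounded _ _ _ P (cst M) M) => // x.
    by rewrite ger0_norm.
  - move=> n x _; rewrite lee_fin normrM (le_trans _ (fM n x))// ler_piMr//.
    exact: cosw_le1.
rewrite /Rintegral; congr fine.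
rewrite -(cvg_lim _ (H mu))// -(cvg_lim _ (H nu))//; congr (lim _).
suff -> : (fun n => (\int[mu]_x (f_ n x * cosw t c x)%:E)%E) =
    (fun n => (\int[nu]_x (f_ n x * cosw t c x)%:E)%E) by [].
apply/funext => n; have [mfn bfn fnE] := fA n.
have fin (P : probability (borelX X) R) :
    (\int[P]_x (f_ n x * cosw t c x)%:E)%E \is a fin_num.
  by apply: integrable_fin_num => //; exact: integrable_cosM.
by rewrite -(fineK (fin mu)) -(fineK (fin nu)); congr EFin; exact: fnE.
Qed.

(** Moves the cosine into [0, 1], the domain of the step polynomials; the threshold one half
    corresponds to a zero of the cosine. *)
Definition half_cosw s d x : R := 2^-1 * (1 + cosw s d x).

Lemma half_cosw_itv s d x : 0 <= half_cosw s d x <= 1.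
Proof.
have := cos_geN1 (ip s x - d); have := cos_le1 (ip s x - d).
by rewrite /half_cosw /cosw => h1 h2; apply/andP; split; lra.
Qed.

Lemma cos_agree_half_coswX s d n f : cos_agree f ->
  cos_agree (fun x => f x * half_cosw s d x ^+ n).
Proof.
move=> fA; elim: n => [|n IH].
  by under eq_fun do rewrite expr0 mulr1.
have := cos_agree_lin 2^-1 2^-1 IH (cos_agree_cosw s d IH).
by congr cos_agree; apply/funext => x; rewrite exprS /half_cosw; ring.
Qed.

Lemma cos_agree_step_poly s d n f : cos_agree f ->
  cos_agree (fun x => f x * step_poly n (half_cosw s d x)).
Proof.
rewrite /step_poly; set m := (n * 2 ^ n)%N => fA; elim: m => [|m IH].
  by under eq_fun do rewrite expr0 mulr1.
have := cos_agree_lin 1 (-1) IH (cos_agree_half_coswX s d n IH).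
by congr cos_agree; apply/funext => x; rewrite exprS; ring.
Qed.

Lemma cos_agree_cosw_lt0 s d f : cos_agree f ->
  cos_agree (fun x => f x * (cosw s d x < 0)%R%:R).
Proof.
move=> fA; have [_ [M fM] _] := fA.
apply: (@cos_agree_cvg (fun n x => f x * step_poly n (half_cosw s d x)) _ M).
- by move=> n; exact: cos_agree_step_poly.
- move=> n x; have /andP[h0 h1] := step_poly_itv n (half_cosw_itv s d x).
  by rewrite normrM (le_trans _ (fM x))// ler_piMr// ger0_norm.
- move=> x; apply: cvgM; first exact: cvg_cst.
  rewrite (_ : (cosw s d x < 0) = (half_cosw s d x < 2^-1)).
    by apply: step_poly_cvg; exact: half_cosw_itv.
  by rewrite /half_cosw; apply/idP/idP => h; lra.
Qed.

(** Once the argument is below [pi] in absolute value, the sine has its sign. Slowing the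
    oscillation thus removes the periodicity in the limit. *)
Lemma sin_div_sign (y : R) :
  \forall n \near \oo, (sin (y / n.+1%:R) < 0) = (y < 0).
Proof.
near=> n.
have n0 : 0 < n.+1%:R :> R by rewrite ltr0n.
have yn : `|y / n.+1%:R| < pi.
  rewrite normrM [`|_^-1|]gtr0_norm ?invr_gt0// ltr_pdivrMr// mulrC -ltr_pdivrMr ?pi_gt0//.
  rewrite -natr1 (@lt_trans _ _ n%:R)// ?ltrDl//.
  by near: n; exact: nbhs_infty_gtr.
have [y0|y0|->] := ltgtP y 0; last by rewrite mul0r sin0 ltxx.
- rewrite -[_ / _]opprK -mulNr sinN oppr_lt0; apply: sin_gt0_pi.
  rewrite divr_gt0 ?oppr_gt0//= mulNr.
  by rewrite (le_lt_trans _ yn)// -normrN ler_norm.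
- apply/negbTE; rewrite -leNgt; apply: ltW; apply: sin_gt0_pi.
  by rewrite divr_gt0//= (le_lt_trans _ yn)// ler_norm.
Unshelve. all: by end_near. Qed.

Lemma cos_agree_halfspace s (r : R) f : cos_agree f ->
  cos_agree (fun x => f x * (ip s x < r)%R%:R).
Proof.
move=> fA; have [_ [M fM] _] := fA.
(* The phase [pi / 2] turns the cosine into the sine of [(ip s x - r) / n.+1%:R]. *)
pose g n x := f x * (cosw (n.+1%:R^-1 *: s) (n.+1%:R^-1 * r + pi / 2) x < 0)%R%:R.
apply: (@cos_agree_cvg g _ M).
- by move=> n; exact: cos_agree_cosw_lt0.
- move=> n x; rewrite /g normrM (le_trans _ (fM x))// ler_piMr//.
  by case: (_ < _); rewrite ?normr1 ?normr0.
- move=> x; apply: cvgM; first exact: cvg_cst.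
  apply: cvg_near_cst; apply: filterS (sin_div_sign (ip s x - r)) => n.
  rewrite subr_lt0 => <-; congr (_ _); congr (_ _); congr (_ < _).
  rewrite /cosw ipZl// opprD addrA cosBpihalf; congr sin.
  by rewrite -mulrBr mulrC.
Qed.

End cosine_uniqueness.

(** * The sigma-algebra of multipliers and equality of the measures *)

Section determination.
Context {R : realType} {X : normedModType R} {ip : X -> X -> R}.
Hypothesis Hip : is_inner_product ip.
Variables mu nu : probability (borelX X) R.

Local Notation agree := (@cos_agree R X ip mu nu).

(** Because the indicator must multiply the whole class into itself, intersections are handled by
    products, and the stable sets form a sigma-algebra rather than only a Dynkin system. *)
Definition cos_stable (B : set (borelX X)) : Prop :=
  forall f, agree f -> agree (fun x => f x * \1_B x).

Lemma cos_stableC B : cos_stable B -> cos_stable (~` B).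
Proof.
move=> BS f fA; have := cos_agree_lin Hip 1 (-1) fA (BS f fA).
congr cos_agree; apply/funext => x; rewrite !indicE in_setC.
by case: (x \in B); rewrite /=; ring.
Qed.

Lemma cos_stable_bigcap (A : (set (borelX X))^nat) :
  (forall n, cos_stable (A n)) -> cos_stable (\bigcap_n A n).
Proof.
move=> AS f fA; have [_ [M fM] _] := fA.
pose F n x := f x * \prod_(k < n) \1_(A k) x.
apply: (@cos_agree_cvg _ _ _ Hip mu nu F _ M).
- elim=> [|n IH]; first by rewrite /F; under eq_fun do rewrite big_ord0 mulr1.
  by rewrite /F; under eq_fun do rewrite big_ord_recr/= mulrA; exact: AS.
- move=> n x; rewrite /F normrM (le_trans _ (fM x))// ler_piMr// normr_prod.
  by apply: prodr_ile1 => k _; rewrite indicE; case: (_ \in _); rewrite ?normr1 ?normr0 ?lexx ler01.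
- move=> x; apply: cvgM; first exact: cvg_cst.
  apply: cvg_near_cst; rewrite indicE.
  have [|] := boolP (x \in \bigcap_n A n).
    rewrite inE => xA; apply: nearW => n; apply: big1 => k _.
    by rewrite indicE mem_set//; exact: xA.
  (* Outside some [A k] the partial products contain a zero factor as soon as [n] exceeds [k]. *)
  rewrite notin_setE => /existsNP[k /not_implyP[_ xAk]].
  near=> n; have kn : (k < n)%N by near: n; exact: nbhs_infty_gt.
  by rewrite (bigD1 (Ordinal kn))//= indicE memNset// mul0r.
Unshelve. all: by end_near. Qed.

Lemma cos_stable_bigcup (A : (set (borelX X))^nat) :
  (forall n, cos_stable (A n)) -> cos_stable (\bigcup_n A n).
Proof.
move=> AS; rewrite -[X in cos_stable X]setCK setC_bigcup.
by apply: cos_stableC; apply: cos_stable_bigcap => n; exact: cos_stableC.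
Qed.

Lemma cos_stable0 : cos_stable set0.
Proof.
move=> f fA; have := cos_agree_lin Hip 0 0 fA fA.
by congr cos_agree; apply/funext => x; rewrite indic0 mulr0; ring.
Qed.

Lemma cos_stable_halfspace (s : X) (r : R) : cos_stable [set x | ip s x <= r].
Proof.
have -> : [set x | ip s x <= r] = ~` [set x | ip (- s) x < - r].
  apply/seteqP; split=> x /=; rewrite -(sub0r s) ipBl// ip0l// sub0r ltrN2.
    by move=> h; apply/negP; rewrite -leNgt.
  by move=> /negP; rewrite -leNgt.
apply: cos_stableC => f fA; have := cos_agree_halfspace Hip (- s) (- r) fA.
congr cos_agree; apply/funext => x; rewrite indicE; congr (_ * (nat_of_bool _)%:R).
by apply/idP/idP; rewrite inE.
Qed.

Lemma separable_sequence : separable_space X ->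
  exists e : nat -> X, forall O : set X, open O -> O !=set0 -> exists k, O (e k).
Proof.
move=> [D [/countable_injP[g gI] dD]].
(* Invert the injection [g] of [D] into [nat]. Off its image the value 0 is harmless, since only
   density of the sequence matters. *)
pose e n : X := if pselect (exists x, D x /\ g x = n) is left h
  then projT1 (cid h) else 0.
exists e => O oO O0; have [x [Ox Dx]] := dD O O0 oO.
exists (g x); rewrite /e; case: pselect => [h|[]]; last by exists x.
by case: (cid h) => y [Dy gy] /=; rewrite (gI y x)// inE.
Qed.

Hypothesis Hsep : separable_space X.

(** By duality the ball is cut out by the half-spaces $\langle d, x-c\rangle \le r\|d\|$, and by
    continuity in $d$ a dense sequence of directions suffices. The homogeneous form allows
    directions of any length. *)
Lemma cos_stable_closed_ball (c : X) (r : R) : 0 <= r ->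
  cos_stable [set x : X | `|x - c| <= r].
Proof.
move=> r0; have [e eD] := separable_sequence Hsep.
have -> : [set x : X | `|x - c| <= r] =
    \bigcap_k [set x : X | ip (e k) x <= r * `|e k| + ip (e k) c].
  apply/seteqP; split=> x /=.
    move=> xr k _ /=; rewrite -lerBlDr -ipBr// (le_trans (ler_norm _))//.
    by rewrite (le_trans (ip_cauchy_schwarz Hip _ _))// mulrC ler_wpM2r.
  move=> H; rewrite leNgt; apply/negP => rx.
  pose h (d : X) := ip d (x - c) - r * `|d|.
  have hl d d' : `|h d - h d'| <= (`|x - c| + r) * `|d - d'|.
    rewrite /h (_ : _ - _ = ip (d - d') (x - c) - r * (`|d| - `|d'|)); last first.
      rewrite (ipBl Hip d d').
      by move: (ip d _) (ip d' _) => u v; ring.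
    rewrite (le_trans (ler_normB _ _))// mulrDl lerD//.
      by rewrite mulrC; exact: ip_cauchy_schwarz.
    by rewrite normrM ger0_norm// ler_wpM2l// ler_dist_dist.
  have oh : open (h @^-1` `]0, +oo[%classic).
    by apply: open_comp => [d _|]; [exact: (lipschitz_continuous hl)|exact: interval_open].
  have [|k] := eD _ oh.
    (* In the direction [x - c] itself, [h] is the norm of [x - c] times its excess over [r]. *)
    exists (x - c); rewrite /= in_itv/= andbT /h ipxx// expr2 -mulrBl.
    by rewrite mulr_gt0 ?subr_gt0// (le_lt_trans r0).
  rewrite /= in_itv/= andbT /h ipBr// => hk.
  by have := H k I; rewrite /=; lra.
by apply: cos_stable_bigcap => k; exact: cos_stable_halfspace.
Qed.

Lemma cos_stable_open (O : set X) : open O -> cos_stable O.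
Proof.
move=> oO; have [e eD] := separable_sequence Hsep.
pose B k n : set X := [set x | `|x - e k| <= n.+1%:R^-1].
have -> : O = \bigcup_k \bigcup_n (if `[< B k n `<=` O >] then B k n else set0).
  apply/seteqP; split=> [x Ox|x [k _ [n _]]]; last first.
    by case: asboolP => // BO /BO.
  have /nbhs_ballP[r /= r0 xrO] : nbhs x O by exact: open_nbhs_nbhs.
  (* A centre within this radius of [x] gives a closed ball that contains [x] and stays within
     distance [r] of it, hence inside [O]. *)
  have [n] : exists n : nat, n.+1%:R^-1 < r / 2 :> R.
    have [n _ /(_ _ (leqnn n)) Hn] : \forall n \near \oo, (n.+1%:R^-1 < r / 2 :> R).
      have := @cvgr_lt _ _ \oo _ (@harmonic R) 0 (@cvg_harmonic R) (r / 2).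
      by apply; rewrite divr_gt0.
    by exists n.
  move=> nr; have n0 : 0 < n.+1%:R^-1 :> R by rewrite invr_gt0 ltr0n.
  have [||k /= xk] := eD (ball x n.+1%:R^-1); first exact: ball_open.
    by exists x; exact: ballxx.
  have xB : B k n x by move: xk; rewrite -ball_normE/= => /ltW.
  exists k => //; exists n => //; case: asboolP => // -[] y yB; apply: xrO.
  rewrite -ball_normE/=.
  rewrite (_ : x - y = (x - e k) - (y - e k)); last first.
    by rewrite opprB addrA subrK.
  rewrite (le_lt_trans (ler_normB _ _))//.
  by rewrite [ltRHS]splitr ltrD//; [exact: le_lt_trans xB nr|exact: le_lt_trans yB nr].
apply: cos_stable_bigcup => k; apply: cos_stable_bigcup => n.
case: asboolP => _; last exact: cos_stable0.
by apply: cos_stable_closed_ball; rewrite invr_ge0 ler0n.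
Qed.

Lemma cos_stable_measurable (A : set (borelX X)) : measurable A -> cos_stable A.
Proof.
apply: smallest_sub => [|O oO]; last exact: cos_stable_open.
split.
- exact: cos_stable0.
- by move=> B BS; rewrite setTD; exact: cos_stableC.
- by move=> B BS; exact: cos_stable_bigcup.
Qed.

Lemma eq_measure_cos :
  (forall t c, \int[mu]_x cosw (ip := ip) t c x = \int[nu]_x cosw (ip := ip) t c x) ->
  forall A : set (borelX X), measurable A -> mu A = nu A.
Proof.
move=> H A mA.
have A1 : agree (cst 1).
  split; first exact: measurable_cst.
  - by exists 1 => x; rewrite normr1.
  - by move=> t c; under eq_Rintegral do rewrite mul1r; rewrite H;
      under [RHS]eq_Rintegral do rewrite mul1r.
(* The constant 1 belongs to the class by hypothesis, hence so does the indicator of [A]. At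
   frequency and phase 0 the cosine is 1, which leaves the measures of [A]. *)
have [_ _ /(_ 0 0)] := cos_stable_measurable mA A1.
have E (P : probability (borelX X) R) :
    \int[P]_x (cst 1 x * \1_A x * cosw (ip := ip) 0 0 x) = fine (P A).
  transitivity (\int[P]_x \1_A x).
    by apply: eq_Rintegral => x _; rewrite /cosw ip0l// subr0 cos0 mulr1 mul1r.
  by rewrite /Rintegral integral_indic// setIT.
rewrite !E => EA.
by rewrite -(fineK (fin_num_measure mu _ mA)) EA fineK// fin_num_measure.
Qed.

End determination.

Lemma eq_measure_wproj (R : realType) (X : normedModType R) (ip : X -> X -> R)
    (p : R) (mu nu : probability (borelX X) R) :
  is_inner_product ip -> separable_space X -> 1 <= p ->
  in_Pp p mu -> in_Pp p nu ->
  (forall t : X, `|t| = 1 -> wproj (ip := ip) p mu nu t = 0) ->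
  forall A : set (borelX X), measurable A -> mu A = nu A.
Proof.
move=> Hip Hsep hp muP nuP w0; apply: (eq_measure_cos Hip Hsep) => t c.
have [->|t0] := eqVneq t 0.
  have E (P : probability (borelX X) R) : \int[P]_x cosw (ip := ip) 0 c x = cos (- c).
    under eq_Rintegral do rewrite /cosw ip0l// sub0r.
    transitivity (cos (- c) * fine (P setT)); first exact: Rintegral_cst.
    by rewrite probability_setT mulr1.
  by rewrite !E.
(* Only unit directions are known to give distance 0, so the length of [t] is moved into the
   frequency [L] of [wass_eq0_cos]. *)
pose s := `|t|^-1 *: t.
have nt0 : `|t| != 0 by rewrite normr_eq0.
have s1 : `|s| = 1 by rewrite normrZ normfV normr_id mulVf.
have E (P : probability (borelX X) R) : \int[P]_x cosw (ip := ip) t c x =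
    \int[P]_x cos (`|t| * Defs.proj ip s x - c).
  by apply: eq_Rintegral => x _; rewrite /cosw /Defs.proj (ipZl Hip) mulrA mulfV// mul1r.
rewrite !E; apply: (@wass_eq0_cos R (proj_push ip mu s) (proj_push ip nu s) p) => //.
- exact: measurable_proj.
- exact: measurable_proj.
- by rewrite -(wprojK Hip hp)// w0.
Qed.

Unset Implicit Arguments.

Theorem mainTheorem3 (R : realType) (X : completeNormedModType R)
  (ip : X -> X -> R)
  (Hip : is_inner_product ip) (Hsep : separable_space X)
  (Hinf : infinite_dimensional X)
  (p : R) (hp : 1 <= p)
  (gamma : {finite_measure set (borelX X) -> \bar R})
  (gamma_S : gamma (~` @sphere R X) = 0%E)
  (gamma_pos : (0 < gamma (@sphere R X))%E)
  (gamma_strict : forall O : set X, open O ->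
      (@sphere R X `&` O) !=set0 -> (0 < gamma (@sphere R X `&` O))%E) :
  forall mu nu rho : probability (borelX X) R,
    in_Pp p mu -> in_Pp p nu -> in_Pp p rho ->
    [/\ (SW ip p gamma mu nu < +oo)%E,
        SW ip p gamma mu nu = SW ip p gamma nu mu,
        (SW ip p gamma mu nu <= SW ip p gamma mu rho + SW ip p gamma rho nu)%E &
        (SW ip p gamma mu nu = 0%E <->
           forall A : set (borelX X), measurable A -> mu A = nu A)].
Proof.
move=> mu nu rho muP nuP rhoP; split.
- exact: SW_lty.
- exact: SW_sym.
- exact: SW_triangle.
- split=> [SW0|]; last exact: SW_eq0_of_eq.
  apply: (eq_measure_wproj Hip Hsep hp muP nuP) => t t1.
  exact: (SW_eq0_wproj Hip hp gamma_pos gamma_strict muP nuP SW0).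
Qed.
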